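(* Let $k\geq 1$ and $n\geq 0$ be integers. Then \[ \left|\mathcal{T}_k(n)\right|=\sum_{\lambda\in\mathcal{D}_k(n)}\bar{\ell}(\lambda)-\sum_{\lambda\in\mathcal{O}_k(n)}\bar{\ell}(\lambda). \]
   Context: A partition of $n$ is a finite nonincreasing sequence of positive integers (its parts) summing to $n$; $\bar{\ell}(\lambda)$ denotes the number of distinct parts of $\lambda$ (distinct part values). For an integer $k\geq 1$: $\mathcal{O}_k(n)$ is the set of partitions of $n$ with no part divisible by $k$; $\mathcal{D}_k(n)$ is the set of partitions of $n$ in which no part occurs $k$ or more times; $\mathcal{T}_k(n)$ is the set of partitions of $n$ in which exactly one part value occurs more than $k$ times and fewer than $2k$ times, while every other part value occurs fewer than $k$ times. *)

(* Defs.v *)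
From HB Require Import structures.
From mathcomp Require Import all_boot all_order all_algebra.

Set Implicit Arguments.
Unset Strict Implicit.
Unset Printing Implicit Defensive.

Definition is_intpart (n : nat) (s : seq nat) : bool :=
  [&& sorted geq s, all (fun i => 0 < i) s & sumn s == n].

Record intpart (n : nat) := IntPart {
  parts :> seq nat;
  _ : is_intpart n parts
}.

HB.instance Definition _ n := [isSub for @parts n].
HB.instance Definition _ n := [Countable of intpart n by <:].

(* Finiteness: a partition of n has at most n parts, each at most n, so it
   embeds into the finite type of sequences over 'I_n.+1 of size at most n. *)
Lemma size_le_sumn (s : seq nat) : all (fun i => 0 < i) s -> size s <= sumn s.
Proof.
elim: s => //= x s IHs /andP[x_gt0 /IHs le_s].
by rewrite -add1n leq_add.
Qed.

Lemma mem_le_sumn (s : seq nat) i : i \in s -> i <= sumn s.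
Proof.
elim: s => //= x s IHs; rewrite inE => /orP[/eqP-> | /IHs le_i].
  exact: leq_addr.
exact: leq_trans le_i (leq_addl _ _).
Qed.

Lemma size_intpart n (l : intpart n) :
  size [seq inord i : 'I_n.+1 | i <- l] <= n.
Proof.
case: l => s /= /and3P[_ s_gt0 /eqP def_n].
by rewrite size_map -[leqRHS]def_n size_le_sumn.
Qed.

Definition bseq_of_intpart n (l : intpart n) : n.-bseq 'I_n.+1 :=
  Bseq (size_intpart l).

Definition intpart_of_bseq n (s : n.-bseq 'I_n.+1) : option (intpart n) :=
  insub [seq val i | i <- s].

Lemma bseq_of_intpartK n : pcancel (@bseq_of_intpart n) (@intpart_of_bseq n).
Proof.
move=> l; rewrite /intpart_of_bseq /= -map_comp.
have -> : [seq (val \o (fun i => inord i : 'I_n.+1)) i | i <- l] = l.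
  rewrite -[RHS]map_id; apply/eq_in_map => i l_i /=.
  rewrite inordK // ltnS; case: l l_i => s /= /and3P[_ _ /eqP <-].
  exact: mem_le_sumn.
exact: valK.
Qed.

HB.instance Definition _ n : isFinite (intpart n) :=
  PCanIsFinite (@bseq_of_intpartK n).

Definition num_distinct_parts n (l : intpart n) : nat := size (undup l).

Definition Ok (k n : nat) : {set intpart n} :=
  [set l : intpart n | all (fun i => ~~ (k %| i)) l].

Definition Dk (k n : nat) : {set intpart n} :=
  [set l : intpart n | all (fun i => ~~ (k <= count_mem i l)) l].

(* "Exactly one part value": undup lists each part value once. *)
Definition Tk (k n : nat) : {set intpart n} :=
  [set l : intpart n |
    let mid i := k < count_mem i l < 2 * k in
    (count mid (undup l) == 1) &&
    all (fun i => mid i || (count_mem i l < k)) l].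

(* Main.v *)
(* Work with generating polynomials modulo X^(n+1).  Let D and O be the
   generating functions of partitions with all multiplicities below k, resp.
   with no part divisible by k; Glaisher's theorem is D = O.  Write F_i for the
   factor 1 + X^i + ... + X^((k-1)i) of D.  Marking the part value i replaces
   F_i by F_i - 1 on the D_k side and by X^(ki) (F_i - 1) on the T_k side, and
   F_i - 1 - X^(ki) (F_i - 1) = (X^i - X^(ki)) F_i.  Summing over i, the terms
   X^i with k dividing i cancel, which leaves the sum of X^i D over the i not
   divisible by k.  On the O_k side, marking such an i amounts to adding one
   part i, i.e. to multiplying O by X^i. *)
Require Import Defs.
From mathcomp Require Import all_boot all_order all_algebra.
From mathcomp Require Import ring zify.

Set Implicit Arguments.
Unset Strict Implicit.
Unset Printing Implicit Defensive.

Import GRing.Theory.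

(** * Partitions and their multiplicity vectors *)

Lemma intpart_sorted n (l : intpart n) : sorted geq l.
Proof. by case: l => s /= /and3P[]. Qed.

Lemma intpart_sumn n (l : intpart n) : sumn l = n.
Proof. by case: l => s /= /and3P[_ _ /eqP]. Qed.

Lemma mem_intpart n (l : intpart n) i : i \in parts l -> 0 < i <= n.
Proof.
move=> l_i; rewrite -[X in i <= X](intpart_sumn l) mem_le_sumn // andbT.
by case: l l_i => s /= /and3P[_ /allP s_gt0 _] /s_gt0.
Qed.

Lemma count_intpart_notin n (l : intpart n) i :
  ~~ (0 < i <= n) -> count_mem i l = 0.
Proof. by move=> iN; apply/count_memPn; apply: contra iN; apply: mem_intpart. Qed.

Lemma all_intpart n (l : intpart n) (a : pred nat) :
  all a l = [forall i : 'I_n, (i.+1 \in parts l) ==> a i.+1].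
Proof.
apply/allP/forallP => [al i | al x lx]; first by apply/implyP/al.
case/andP: (mem_intpart lx); case: x lx => // x lx _ ltxn.
exact: (implyP (al (Ordinal ltxn))).
Qed.

Lemma sumn_count_mem n (s : seq nat) :
  all (fun i => 0 < i <= n) s ->
  sumn s = \sum_(i < n) i.+1 * count_mem i.+1 s.
Proof.
elim: s => [|x s IHs] /=; first by rewrite big1 // => i _; rewrite muln0.
case/andP=> /andP[x_gt0 le_x_n] /IHs->.
have lt_x_n : x.-1 < n by rewrite prednK.
under [RHS]eq_bigr do rewrite mulnDr.
rewrite [RHS]big_split; congr (_ + _).
rewrite (bigD1 (Ordinal lt_x_n)) //= prednK // eqxx muln1 big1 ?addn0 // => i.
case: (x =P i.+1) => [def_x | _ _]; last by rewrite /= muln0.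
by rewrite -val_eqE /= def_x eqxx.
Qed.

Lemma count_undup_intpart n (l : intpart n) (a : pred nat) :
  (forall i, a i -> i \in parts l) ->
  count a (undup l) = \sum_(i < n) a i.+1.
Proof.
move=> al; transitivity (count a (iota 1 n)).
  rewrite -!size_filter; apply: perm_size; apply: uniq_perm.
  - by rewrite filter_uniq ?undup_uniq.
  - by rewrite filter_uniq ?iota_uniq.
  move=> i; rewrite !mem_filter mem_undup mem_iota add1n ltnS.
  by case: (boolP (a i)) => //= /al li; rewrite li (mem_intpart li).
rewrite -(big_mkord xpredT (fun i => a i.+1 : nat)).
rewrite -(big_add1 _ _ 0 n.+1 xpredT (fun i => a i : nat)).
by rewrite /index_iota subn1 -sum1_count [LHS]big_mkcond.
Qed.

(** Index [i] stands for the part value [i.+1]. No multiplicity exceeds [n], so [inord] loses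
    nothing once [n <= B]. *)
Definition mult_ffun n B (l : intpart n) : {ffun 'I_n -> 'I_B.+1} :=
  [ffun i : 'I_n => inord (count_mem i.+1 l)].

Lemma count_intpart_le n (l : intpart n) i : count_mem i l <= n.
Proof.
rewrite -[leqRHS](intpart_sumn l); apply: leq_trans (count_size _ _) _.
by apply: size_le_sumn; case: l => s /= /and3P[].
Qed.

Lemma mult_ffunE n B (l : intpart n) i :
  n <= B -> mult_ffun B l i = count_mem i.+1 l :> nat.
Proof.
by move=> leB; rewrite ffunE inordK // ltnS (leq_trans (count_intpart_le l _)).
Qed.

(** Equal multiplicities make the two sequences permutations of each other, and both are sorted. *)
Lemma mult_ffun_inj n B : n <= B -> injective (@mult_ffun n B).
Proof.
move=> leB l1 l2 /ffunP eq12; apply/val_inj.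
apply: (sorted_eq _ _ (intpart_sorted l1) (intpart_sorted l2)).
- by move=> x y z /= yx xz; apply: leq_trans xz yx.
- by move=> x y /= /andP[? ?]; apply/eqP; rewrite eqn_leq; apply/andP.
apply/allP => x _ /=; apply/eqP.
have [/andP[x_gt0 lexn]|xN] := boolP (0 < x <= n); last first.
  by rewrite !count_intpart_notin.
have ltxn: x.-1 < n by rewrite prednK.
move: (congr1 val (eq12 (Ordinal ltxn))).
by rewrite /= !mult_ffunE //= prednK.
Qed.

Lemma mult_ffun_surj n B (f : {ffun 'I_n -> 'I_B.+1}) :
  n <= B -> \sum_(i < n) i.+1 * f i = n -> exists l, f = mult_ffun B l.
Proof.
move=> leB sumf.
(* Each value [i.+1] is repeated [f i] times; sorting the result gives the partition. *)
pose s := flatten [seq nseq (f i) i.+1 | i <- enum 'I_n].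
have s_n : all (fun i => 0 < i <= n) s.
  apply/allP=> x /flattenP[_ /mapP[i _ ->]].
  by rewrite mem_nseq => /andP[_ /eqP->] /=.
have s_count (i : 'I_n) : count_mem i.+1 s = f i.
  rewrite count_flatten -map_comp sumnE big_map big_enum /= (bigD1 i) //=.
  rewrite count_nseq /= eqxx mul1n big1 ?addn0 // => j /negPf ne_ji.
  by rewrite count_nseq /= eqSS val_eqE ne_ji.
have s_part : is_intpart n (sort geq s).
  apply/and3P; split.
  - by apply: sort_sorted => x y /=; apply: leq_total.
  - by rewrite all_sort; apply: sub_all s_n => x /andP[].
  rewrite (perm_sumn (_ : perm_eq _ s)) ?perm_sort //.
  rewrite (sumn_count_mem s_n); apply/eqP; rewrite -[RHS]sumf.
  apply: eq_bigr => i _; by rewrite s_count.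
exists (IntPart s_part); apply/ffunP => i; apply/val_inj.
by rewrite /= mult_ffunE //= count_sort s_count.
Qed.

(** * Counting partitions by coefficients of products *)

Local Open Scope ring_scope.

(* Multiplicities are truncated at B so that the factors stay polynomials. *)
Definition multpoly (B i : nat) (P : pred nat) : {poly rat} :=
  \sum_(j < B.+1 | P j) 'X^(i * j).

(** Expanding the product chooses an allowed multiplicity for every part value. The exponent of the
    resulting monomial is the weighted sum of the choices, so the coefficient at [n] counts the
    multiplicity vectors of partitions of [n]. *)
Lemma card_intpart_mult n B (A : nat -> pred nat) : (n <= B)%N ->
  #|[set l : intpart n | [forall i : 'I_n, A i.+1 (count_mem i.+1 l)]]|%:R =
  (\prod_(i < n) multpoly B i.+1 (A i.+1))`_n.
Proof.
move=> leB; rewrite /multpoly.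
rewrite (bigA_distr_big_dep (fun (i : 'I_n) (j : 'I_B.+1) => A i.+1 j)
  (fun (i : 'I_n) (j : 'I_B.+1) => 'X^(i.+1 * j))) coef_sum.
rewrite -(card_imset _ (mult_ffun_inj leB)) -sum1_card natr_sum.
rewrite [LHS]big_mkcond [RHS]big_mkcond; apply: eq_bigr => f _ /=.
rewrite prodrXr coefXn.
case: imsetP => [[l] | fN].
  rewrite inE => /forallP Al ->; rewrite ifT; last first.
    by apply/familyP => i; rewrite unfold_in /= mult_ffunE ?Al.
  rewrite [in X in n == X](eq_bigr (fun i : 'I_n => i.+1 * count_mem i.+1 l)%N).
    rewrite -sumn_count_mem ?intpart_sumn ?eqxx //.
    by apply/allP => i; apply: mem_intpart.
  by move=> i _; rewrite mult_ffunE.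
case: familyP => // Af; case: eqP => // /esym/(mult_ffun_surj leB)[l def_f].
case: fN; exists l => //; rewrite inE; apply/forallP => i.
by rewrite -(mult_ffunE _ _ leB) -def_f; apply: Af.
Qed.

(** * Congruence modulo ['X^(n.+1)] *)

Definition eqmodX n (p q : {poly rat}) := 'X^(n.+1) %| p - q.

Lemma eqmodX_refl n p : eqmodX n p p.
Proof. by rewrite /eqmodX subrr dvdp0. Qed.

Lemma eqmodX_sym n p q : eqmodX n p q -> eqmodX n q p.
Proof. by rewrite /eqmodX -opprB dvdpNr. Qed.

Lemma eqmodX_trans n q p r : eqmodX n p q -> eqmodX n q r -> eqmodX n p r.
Proof. by move=> pq qr; rewrite /eqmodX -(subrKA q) dvdp_add. Qed.

Lemma eqmodXD n p q p' q' :
  eqmodX n p q -> eqmodX n p' q' -> eqmodX n (p + p') (q + q').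
Proof. by move=> pq pq'; rewrite /eqmodX opprD addrACA dvdp_add. Qed.

Lemma eqmodXM n p q p' q' :
  eqmodX n p q -> eqmodX n p' q' -> eqmodX n (p * p') (q * q').
Proof.
move=> pq pq'; rewrite /eqmodX.
have ->: p * p' - q * q' = (p - q) * p' + q * (p' - q') by ring.
by apply: dvdp_add; [apply: dvdp_mulr | apply: dvdp_mull].
Qed.

Lemma eqmodX_sum n I (r : seq I) (P : pred I) (F G : I -> {poly rat}) :
  (forall i, P i -> eqmodX n (F i) (G i)) ->
  eqmodX n (\sum_(i <- r | P i) F i) (\sum_(i <- r | P i) G i).
Proof.
move=> FG; apply: (big_ind2 (eqmodX n)) => //; first exact: eqmodX_refl.
by move=> p q p' q'; apply: eqmodXD.
Qed.

Lemma eqmodX_prod n I (r : seq I) (P : pred I) (F G : I -> {poly rat}) :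
  (forall i, P i -> eqmodX n (F i) (G i)) ->
  eqmodX n (\prod_(i <- r | P i) F i) (\prod_(i <- r | P i) G i).
Proof.
move=> FG; apply: (big_ind2 (eqmodX n)) => //; first exact: eqmodX_refl.
by move=> p q p' q'; apply: eqmodXM.
Qed.

Lemma eqmodXn n m p q : (n < m)%N -> eqmodX n (p + 'X^m * q) p.
Proof.
by move=> ltnm; rewrite /eqmodX addrAC subrr add0r dvdp_mulr ?dvdp_exp2l.
Qed.

Lemma eqmodX_coef n p q : eqmodX n p q -> p`_n = q`_n.
Proof.
rewrite /eqmodX => /dvdpP[r pq]; apply/eqP; rewrite -subr_eq0 -coefB pq.
by rewrite coefMXn ltnSn.
Qed.

(** A nonzero constant term makes [r] coprime to every power of ['X], so it can be cancelled. *)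
Lemma eqmodX_mulIl n r p q :
  r.[0] != 0 -> eqmodX n (r * p) (r * q) -> eqmodX n p q.
Proof.
move=> r0; rewrite /eqmodX -mulrBr Gauss_dvdpr //.
by rewrite coprimep_expl // coprimep_sym coprimepX.
Qed.

(** * Sums and products over multiples of [k] *)

Section BigMultiples.
Variables (R : Type) (idx : R) (op : Monoid.com_law idx).

(** Both sides run over the first [n %/ k] multiples of [k]. An arbitrary commutative operation
    serves the sum and the product alike. *)
Lemma big_dvdn (k n : nat) (G : nat -> R) : (0 < k)%N ->
  \big[op/idx]_(i < n | (k %| i.+1)%N) G i.+1 =
  \big[op/idx]_(i < n | (k * i.+1 <= n)%N) G (k * i.+1)%N.
Proof.
move=> k_gt0; transitivity (\big[op/idx]_(i < (n %/ k)%N) G (k * i.+1)%N).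
  elim: n => [|n IHn]; first by rewrite div0n !big_ord0.
  rewrite big_mkcond big_ord_recr -big_mkcond /= IHn divnS //.
  case: ifP => [k_n|_]; last by rewrite Monoid.mulm1.
  rewrite add1n big_ord_recr /=; congr (op _ (G _)).
  by have := divnS n k_gt0; rewrite k_n add1n => <-; rewrite mulnC divnK.
rewrite (big_ord_widen _ (fun i => G (k * i.+1)%N) (leq_div n k)).
by apply: eq_bigl => i; rewrite leq_divRL // mulnC.
Qed.
End BigMultiples.

Lemma eqmodX_sum_multiples k n : (0 < k)%N ->
  eqmodX n (\sum_(i < n) 'X^(k * i.+1)) (\sum_(i < n | (k %| i.+1)%N) 'X^(i.+1)).
Proof.
move=> k_gt0; rewrite (big_dvdn _ n (fun i => 'X^i)) //.
rewrite [X in eqmodX _ _ X]big_mkcond /=.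
(* The surplus terms have exponent above [n], hence vanish modulo ['X^(n.+1)]. *)
apply: eqmodX_sum => i _; case: leqP => [_|lt_n]; first exact: eqmodX_refl.
by rewrite -['X^_]add0r -['X^_]mulr1 eqmodXn.
Qed.

Lemma eqmodX_prod_multiples k n : (0 < k)%N ->
  eqmodX n (\prod_(i < n) (1 - 'X^(k * i.+1)))
           (\prod_(i < n | (k %| i.+1)%N) (1 - 'X^(i.+1))).
Proof.
move=> k_gt0; rewrite (big_dvdn _ n (fun i => 1 - 'X^i)) //.
rewrite [X in eqmodX _ _ X]big_mkcond /=.
apply: eqmodX_prod => i _; case: leqP => [_|lt_n]; first exact: eqmodX_refl.
by rewrite -['X^_]mulr1 -mulrN eqmodXn.
Qed.

(** * Identities for the factor of a single part value *)

Lemma eq_multpoly B i P Q : (forall j, (j <= B)%N -> P j = Q j) ->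
  multpoly B i P = multpoly B i Q.
Proof. by move=> PQ; apply: eq_bigl => j; apply/PQ/leq_ord. Qed.

Lemma multpolyU B i P Q : (forall j, ~~ (P j && Q j)) ->
  multpoly B i (fun j => P j || Q j) = multpoly B i P + multpoly B i Q.
Proof.
move=> dPQ; rewrite /multpoly (bigID (fun j : 'I__ => P j)) /=.
by congr (_ + _); apply: eq_bigl => j; move: (dPQ j); case: (P j) (Q j) => [] [].
Qed.

Lemma multpoly0 B i : multpoly B i (pred1 0%N) = 1.
Proof. by rewrite /multpoly (big_pred1 ord0) // muln0 expr0. Qed.

Lemma multpoly_split0 B i (P : pred nat) : P 0%N ->
  multpoly B i P = 1 + multpoly B i (fun j => P j && (0 < j)%N).
Proof.
move=> P0; rewrite -(multpoly0 B i) -multpolyU; last by case=> [|j]; rewrite ?andbF.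
by apply: eq_multpoly => -[|j] _ //=; rewrite andbT.
Qed.

(** This is the finite geometric sum; the bound on [k] ensures that truncation at [B] removes no
    term. *)
Lemma multpoly_ltn B i k : (k <= B.+1)%N ->
  (1 - 'X^i) * multpoly B i (fun j => (j < k)%N) = 1 - 'X^(k * i).
Proof.
move=> leB; rewrite /multpoly -(big_ord_widen _ (fun j => 'X^(i * j)) leB).
under eq_bigr do rewrite exprM.
by rewrite mulnC exprM -[1 - 'X^i]opprB mulNr -subrX1 opprB.
Qed.

(** Subtracting [k] from a multiplicity strictly between [k] and [2 * k] leaves one strictly between
    0 and [k]. *)
Lemma multpoly_shift B i k : (2 * k <= B)%N -> (0 < k)%N ->
  multpoly B i (fun j => (k < j < 2 * k)%N) =
  'X^(k * i) * multpoly B i (fun j => (j < k)%N && (0 < j)%N).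
Proof.
move=> leB k_gt0; rewrite /multpoly.
rewrite (eq_bigl (fun j : 'I_B.+1 => (k < j)%N && (j < 2 * k)%N)) //.
rewrite -(big_ord_widen_cond B.+1 (fun j => (k < j)%N) (fun j => 'X^(i * j)));
  last by rewrite ltnW.
rewrite (eq_bigl (fun j : 'I_B.+1 => (0 < j)%N && (j < k)%N)) => [|j]; last first.
  by rewrite andbC.
rewrite -(big_ord_widen_cond B.+1 (fun j => (0 < j)%N) (fun j => 'X^(i * j)));
  last by lia.
rewrite -(big_mkord (fun j => (k < j)%N) (fun j => 'X^(i * j))).
rewrite (@big_cat_nat _ _ _ k) //=; last by lia.
rewrite big_nat_cond big_pred0 ?add0r => [|j]; last by lia.
rewrite -{1}[k]add0n big_addn (_ : 2 * k - k = k)%N; last by lia.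
rewrite big_mkord mulr_sumr; apply: eq_big => [j|j _]; first by lia.
by rewrite mulnDr exprD mulrC (mulnC k).
Qed.

Lemma multpoly_diff B i k : (2 * k <= B)%N -> (0 < k)%N ->
  multpoly B i (fun j => (j < k)%N && (0 < j)%N)
    - multpoly B i (fun j => (k < j < 2 * k)%N) =
  ('X^i - 'X^(k * i)) * multpoly B i (fun j => (j < k)%N).
Proof.
move=> leB k_gt0; rewrite multpoly_shift //.
have leB1 : (k <= B.+1)%N by lia.
move: (multpoly_ltn i leB1).
rewrite multpoly_split0 // => geo.
set s := multpoly _ _ _ in geo *.
(* The geometric sum is solved for ['X^(k * i)], which turns the goal into a polynomial identity in
   ['X^i] and [s]. *)
have ->: 'X^(k * i) = 1 - (1 - 'X^i) * (1 + s) by rewrite geo; ring.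
by ring.
Qed.

(** * Counting partitions with one marked part value *)

Lemma card_intpart_at n B (i : 'I_n) (P : pred nat) (A : nat -> pred nat) :
  (n <= B)%N ->
  #|[set l : intpart n | P (count_mem i.+1 l) &&
      [forall j : 'I_n, (j != i) ==> A j.+1 (count_mem j.+1 l)]]|%:R =
  (multpoly B i.+1 P * \prod_(j < n | j != i) multpoly B j.+1 (A j.+1))`_n.
Proof.
move=> leB; pose A' x := if x == i.+1 then P else A x.
have A'i : A' i.+1 = P by rewrite /A' eqxx.
have A'j (j : 'I_n) : j != i -> A' j.+1 = A j.+1.
  by rewrite /A' eqSS val_eqE => /negPf->.
transitivity ((\prod_(j < n) multpoly B j.+1 (A' j.+1))`_n); last first.
  rewrite (bigD1 i) //= A'i; congr (nth 0 (polyseq (_ * _)) n).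
  by apply: eq_bigr => j /A'j->.
rewrite -card_intpart_mult //; congr _%:R; apply: eq_card => l.
rewrite !inE; apply/andP/forallP => [[Pi /forallP Aj] j | A'l].
  have [-> | ne_ji] := eqVneq j i; first by rewrite A'i.
  by rewrite A'j //; apply: (implyP (Aj j)).
split; first by rewrite -A'i.
by apply/forallP=> j; apply/implyP => ne_ji; rewrite -A'j.
Qed.

(** Double counting of pairs of a partition and one of its part values: for a fixed value, its
    multiplicity must also be positive, which changes a single factor of the product. *)
Lemma sum_num_distinct_parts n B (A : nat -> pred nat) : (n <= B)%N ->
  (\sum_(l in [set l : intpart n |
                [forall i : 'I_n, A i.+1 (count_mem i.+1 l)]])
      num_distinct_parts l)%N%:R =
  (\sum_(i < n) multpoly B i.+1 (fun j => A i.+1 j && (0 < j)%N) *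
     \prod_(j < n | j != i) multpoly B j.+1 (A j.+1))`_n.
Proof.
move=> leB; rewrite coef_sum.
under [RHS]eq_bigr do rewrite -card_intpart_at //.
rewrite -natr_sum; congr _%:R.
under eq_bigr => l _.
  rewrite /num_distinct_parts -count_predT.
  rewrite (eq_in_count (_ : {in undup l, predT =1 (fun i => i \in parts l)})); last first.
    by move=> i; rewrite mem_undup => ->.
  rewrite count_undup_intpart //; over.
rewrite exchange_big; apply: eq_bigr => i _ /=.
rewrite -sum1_card [LHS]big_mkcond [RHS]big_mkcond; apply: eq_bigr => l _.
rewrite !inE -has_pred1 has_count.
rewrite (_ : [forall j : 'I_n, _] = A i.+1 (count_mem i.+1 l) &&
  [forall j : 'I_n, (j != i) ==> A j.+1 (count_mem j.+1 l)]); last first.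
  apply/forallP/andP => [Al | [Ai /forallP Al] j].
    by split=> //; apply/forallP => j; rewrite Al implybT.
  by have [->|ne_ji] := eqVneq j i; last exact: (implyP (Al j)).
by rewrite -andbA andbCA; case: (0 < _)%N => //=; case: ifP.
Qed.

(** The marked value is the one with multiplicity strictly between [k] and [2 * k]. It is unique, so
    each partition of [Tk k n] is counted in exactly one summand. *)
Lemma card_Tk n B k : (n <= B)%N -> (0 < k)%N ->
  #|Tk k n|%:R =
  (\sum_(i < n) multpoly B i.+1 (fun j => (k < j < 2 * k)%N) *
     \prod_(j < n | j != i) multpoly B j.+1 (fun m => (m < k)%N))`_n.
Proof.
move=> leB k_gt0; rewrite coef_sum.
pose mid j := (k < j < 2 * k)%N.
under [RHS]eq_bigr => i _.
  rewrite -(card_intpart_at i _ (fun _ m => (m < k)%N)) //; over.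
rewrite -natr_sum; congr _%:R; rewrite -sum1_card big_mkcond /=.
under [RHS]eq_bigr do rewrite -sum1_card big_mkcond /=.
rewrite exchange_big; apply: eq_bigr => l _ /=.
rewrite inE /= (count_undup_intpart (a := fun i => mid (count_mem i l))); last first.
  by move=> i; rewrite -has_pred1 has_count /mid; lia.
rewrite all_intpart.
under eq_bigr do rewrite inE.
(* Without a value of middle multiplicity both sides are 0; otherwise only the summand at such a
   value [i] can be nonzero. *)
have [i mid_i | mid0] := pickP (fun i : 'I_n => mid (count_mem i.+1 l));
  last first.
  rewrite big1 => [|i _]; last by rewrite mid0.
  by rewrite big1 // => i _; move: (mid0 i); rewrite /mid => ->.
rewrite [RHS](bigD1 i) //=.
rewrite [X in _ = (_ + X)%N]big1 ?addn0 => [|j ne_ji].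
  congr (if _ then _ else _); rewrite (bigD1 i) //= mid_i eqSS.
  rewrite -/(mid (count_mem i.+1 l)) mid_i andTb.
  rewrite sum_nat_eq0.
  apply/andP/forallP => [[/forallP /= none /forallP al] j|al].
    apply/implyP => ne_ji; move/implyP: (none j) => /(_ ne_ji).
    rewrite eqb0 => midj.
    case: (boolP (j.+1 \in parts l)) => [lj|/count_memPn->//].
    by have /implyP/(_ lj)/orP[mj|//] := al j; rewrite /mid mj in midj.
  split; apply/forallP => j; apply/implyP.
    by move/(implyP (al j)); rewrite eqb0 /mid; lia.
  move=> _; have [->|] := eqVneq j i; first by apply/orP; left.
  by move/(implyP (al j)) ->; rewrite orbT.
(* The summand at [j] would require multiplicity below [k] at [i], where it exceeds [k]. *)
rewrite ifF //; apply/negbTE; apply/nandP; right.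
rewrite negb_forall; apply/existsP; exists i; rewrite negb_imply eq_sym ne_ji /=.
by case/andP: mid_i => lt_k _; rewrite -leqNgt ltnW.
Qed.

Lemma DkE k n : (0 < k)%N ->
  Dk k n = [set l : intpart n | [forall i : 'I_n, (count_mem i.+1 l < k)%N]].
Proof.
move=> k_gt0; apply/setP => l; rewrite !inE all_intpart.
apply: eq_forallb => i; rewrite -ltnNge.
by case: (boolP (_ \in _)) => //= /count_memPn->.
Qed.

Lemma OkE k n :
  Ok k n = [set l : intpart n |
    [forall i : 'I_n, (k %| i.+1)%N ==> (count_mem i.+1 l == 0)%N]].
Proof.
apply/setP => l; rewrite !inE all_intpart; apply: eq_forallb => i.
rewrite -implybNN negbK; congr (_ ==> _).
exact: (sameP count_memPn eqP).
Qed.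

(** * Glaisher's theorem and the generating function identity *)

Section GeneratingPolynomials.
Variables (k n B : nat).
Hypotheses (k_gt0 : (0 < k)%N) (leB : (n + 2 * k <= B)%N).

Definition lt_mult (m : nat) : bool := (m < k)%N.
Definition nondiv_mult (i m : nat) : bool := (k %| i)%N ==> (m == 0)%N.

(** If [k] divides [i.+1], only multiplicity 0 is allowed and the factor is 1. Otherwise the factor
    is a geometric sum up to [B], and the remainder ['X^(B.+1 * i.+1)] has exponent above [n]. *)
Lemma geom_nondiv_mult i :
  eqmodX n ((1 - 'X^(i.+1)) * multpoly B i.+1 (nondiv_mult i.+1))
           (if (k %| i.+1)%N then 1 - 'X^(i.+1) else 1).
Proof.
case: ifP => k_i.
  rewrite (@eq_multpoly _ _ _ (pred1 0%N)) => [|j _].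
    by rewrite multpoly0 mulr1; apply: eqmodX_refl.
  by rewrite /nondiv_mult k_i.
rewrite (@eq_multpoly _ _ _ (fun j => (j < B.+1)%N)) => [|j le_j].
  rewrite multpoly_ltn // -['X^_]mulr1 -mulrN eqmodXn //.
  by rewrite (leq_trans _ (leq_pmulr _ _)) // ltnS; lia.
by rewrite /nondiv_mult k_i ltnS le_j.
Qed.

Lemma nondiv_mult_pos i :
  eqmodX n (multpoly B i.+1 (fun m => nondiv_mult i.+1 m && (0 < m)%N))
           ((if (k %| i.+1)%N then 0 else 'X^(i.+1))
              * multpoly B i.+1 (nondiv_mult i.+1)).
Proof.
have nd0 : nondiv_mult i.+1 0 by rewrite /nondiv_mult eqxx implybT.
case: ifP => k_i.
  rewrite mul0r [X in eqmodX _ X]big_pred0; first exact: eqmodX_refl.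
  by move=> j; rewrite /nondiv_mult k_i /=; case: (nat_of_ord j).
have := geom_nondiv_mult i; rewrite k_i (multpoly_split0 _ _ nd0).
(* The two differences coincide: [(1 - x) * (1 + s) - 1 = s - x * (1 + s)] for [x = 'X^(i.+1)]. *)
rewrite /eqmodX; set s := multpoly _ _ _; congr (_ %| _); ring.
Qed.

(** [lt_gen] and [nondiv_gen] agree with the series D and O modulo ['X^(n.+1)]. *)
Definition lt_gen := \prod_(i < n) multpoly B i.+1 lt_mult.
Definition nondiv_gen := \prod_(i < n) multpoly B i.+1 (nondiv_mult i.+1).

(** Multiplied by the product of all [1 - 'X^(i.+1)], whose constant term is 1, both sides become
    the product of these factors over the multiples of [k]. *)
Lemma glaisher : eqmodX n lt_gen nondiv_gen.
Proof.
apply: (@eqmodX_mulIl _ (\prod_(i < n) (1 - 'X^(i.+1)))).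
  rewrite horner_prod; apply/prodf_neq0 => i _.
  by rewrite !hornerE expr0n subr0 oner_eq0.
rewrite -!big_split /=.
rewrite (eq_bigr (fun i : 'I_n => 1 - 'X^(k * i.+1))) => [|i _]; last first.
  by rewrite multpoly_ltn //; lia.
apply: eqmodX_trans (eqmodX_prod_multiples n k_gt0) _.
rewrite big_mkcond; apply: eqmodX_prod => i _.
exact/eqmodX_sym/geom_nondiv_mult.
Qed.

(** By [multpoly_diff], each difference contains the factor missing from the product at [i], which
    completes it to [lt_gen]. *)
Lemma sum_lt_sub_mid :
  \sum_(i < n) multpoly B i.+1 (fun m => lt_mult m && (0 < m)%N) *
     \prod_(j < n | j != i) multpoly B j.+1 lt_mult -
  \sum_(i < n) multpoly B i.+1 (fun m => (k < m < 2 * k)%N) *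
     \prod_(j < n | j != i) multpoly B j.+1 lt_mult =
  (\sum_(i < n) ('X^(i.+1) - 'X^(k * i.+1))) * lt_gen.
Proof.
rewrite -sumrB mulr_suml; apply: eq_bigr => i _.
rewrite -mulrBl multpoly_diff //; last by lia.
by rewrite -mulrA [lt_gen](bigD1 i).
Qed.

Lemma sum_nondiv :
  eqmodX n
    (\sum_(i < n) multpoly B i.+1 (fun m => nondiv_mult i.+1 m && (0 < m)%N) *
       \prod_(j < n | j != i) multpoly B j.+1 (nondiv_mult j.+1))
    ((\sum_(i < n) (if (k %| i.+1)%N then 0 else 'X^(i.+1))) * nondiv_gen).
Proof.
rewrite mulr_suml; apply: eqmodX_sum => i _.
rewrite [nondiv_gen](bigD1 i) //= mulrA.
exact: eqmodXM (nondiv_mult_pos i) (eqmodX_refl _ _).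
Qed.

Lemma sum_nondivisible_powers :
  eqmodX n (\sum_(i < n) ('X^(i.+1) - 'X^(k * i.+1)))
           (\sum_(i < n) (if (k %| i.+1)%N then 0 else 'X^(i.+1))).
Proof.
have /eqmodX_sym := eqmodX_sum_multiples n k_gt0.
rewrite sumrB big_mkcond /= /eqmodX => mult; rewrite addrAC -sumrB.
rewrite (eq_bigr (fun i : 'I_n => if (k %| i.+1)%N then 'X^(i.+1) else 0)) //.
by move=> i _; case: ifP => _; rewrite ?subr0 ?subrr.
Qed.

Lemma gen_identity :
  eqmodX n
   (\sum_(i < n) multpoly B i.+1 (fun m => lt_mult m && (0 < m)%N) *
     \prod_(j < n | j != i) multpoly B j.+1 lt_mult -
    \sum_(i < n) multpoly B i.+1 (fun m => (k < m < 2 * k)%N) *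
     \prod_(j < n | j != i) multpoly B j.+1 lt_mult)
   (\sum_(i < n) multpoly B i.+1 (fun m => nondiv_mult i.+1 m && (0 < m)%N) *
       \prod_(j < n | j != i) multpoly B j.+1 (nondiv_mult j.+1)).
Proof.
rewrite sum_lt_sub_mid; apply: eqmodX_trans (eqmodX_sym sum_nondiv).
exact: eqmodXM sum_nondivisible_powers glaisher.
Qed.

End GeneratingPolynomials.

Local Close Scope ring_scope.

Theorem theorem1p9 (k n : nat) (hk : 1 <= k) :
  (#|Tk k n|%:Z =
   (\sum_(l in Dk k n) num_distinct_parts l)%N%:Z -
   (\sum_(l in Ok k n) num_distinct_parts l)%N%:Z)%R.
Proof.
(* The summand [n] lets [B] bound all multiplicities in partitions of [n]; [2 * k] keeps the middle
   range of multiplicities untruncated. *)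
pose B := (n + 2 * k)%N.
have leB : n <= B by rewrite leq_addr.
have /eqmodX_coef := gen_identity hk (leqnn B).
rewrite coefB -(sum_num_distinct_parts (fun _ => lt_mult k) leB).
rewrite -(card_Tk leB hk) -(sum_num_distinct_parts (nondiv_mult k) leB).
rewrite -OkE -(DkE _ hk) => id_rat.
(* The coefficient identity holds in [rat] and descends to the integers by injectivity. *)
apply: (@intr_inj rat); rewrite rmorphB /= -!pmulrn -id_rat.
by rewrite opprB addrC subrK.
Qed.
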